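(* Let $N$ be an even positive integer, let $R>0$ be a real number, let $A(0),A(1),\dots,A(N/2-1)$ be complex numbers, and let $$J(\tau)=\sum_{u=0}^{N/2-1}\Bigl|A(u)+R\exp\bigl(j\tfrac{2\pi}{N}\tau u\bigr)\Bigr|^2,\qquad \tau=-N/2,\dots,N/2-1.$$ Then $$A(u)=\frac1{RN}\sum_{\tau=-N/2}^{N/2-1}J(\tau)\exp\bigl(j\tfrac{2\pi}{N}\tau u\bigr),\qquad u=1,\dots,N/2-1,$$ $$|A(0)+R|^2=\frac1N\sum_{\tau=-N/2}^{N/2-1}J(\tau)-\Bigl(\sum_{u_1=1}^{N/2-1}|A(u_1)|^2+\sum_{u_1=1}^{N/2-1}R^2\Bigr).$$ Moreover, let $a(u)$, $u=1,\dots,N$, be defined in either of the following two ways: $$a(u)=\mathrm{IFFT}(J)(u)\cdot\exp(-j\pi(u-1))\qquad\text{or}\qquad a(u)=\mathrm{IFFT}(\mathrm{fftshift}(J))(u),$$ where $J$ denotes the sequence $(J(-N/2),J(-N/2+1),\dots,J(N/2-1))$. Then, in each of the two cases, $$A(u)=\frac1R\,a(u+1),\qquad u=1,2,\dots,N/2-1,$$ $$|A(0)+R|^2=\frac1N\sum_{\tau=-N/2}^{N/2-1}J(\tau)-\Bigl(\sum_{u_1=1}^{N/2-1}|A(u_1)|^2+\sum_{u_1=1}^{N/2-1}R^2\Bigr).$$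
   Context: Here $j$ is the imaginary unit. For a sequence $y=(y_1,\dots,y_N)$ of complex numbers, the inverse FFT (MATLAB convention) is the sequence indexed by $u=1,\dots,N$ given by $$\mathrm{IFFT}(y)(u)=\frac1N\sum_{k=1}^{N}y_k\exp\bigl(j\tfrac{2\pi}{N}(k-1)(u-1)\bigr).$$ Applied to the sequence $(J(-N/2),\dots,J(N/2-1))$, this means $y_k=J(k-1-N/2)$, $k=1,\dots,N$. The operation $\mathrm{fftshift}$ circularly shifts this sequence so that the entry $\tau=0$ comes first: $\mathrm{fftshift}(J)=(J(0),J(1),\dots,J(N/2-1),J(-N/2),J(-N/2+1),\dots,J(-1))$. *)

(* Defs.v *)
From HB Require Import structures.
From mathcomp Require Import all_boot all_order all_algebra.
From mathcomp Require Import complex.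
From mathcomp Require Import reals sequences exp trigo.

Set Implicit Arguments.
Unset Strict Implicit.
Unset Printing Implicit Defensive.

Import Order.TTheory GRing.Theory Num.Theory.
Local Open Scope ring_scope.
Local Open Scope complex_scope.

Definition cexp (T : realType) (z : T[i]) : T[i] :=
  (expR (complex.Re z))%:C *
  (cos (complex.Im z) +i* sin (complex.Im z)).

(* exp(j (2 pi / N) x) *)
Definition fourier_exp (T : realType) (N : nat) (x : int) : T[i] :=
  cexp ('i%C * (2 * pi / N%:R)%:C * x%:~R).

(* The indices tau = -N/2, ..., N/2 - 1 in increasing order (N even). *)
Definition centered (N : nat) : seq int :=
  [seq k%:Z - (N./2)%:Z | k <- iota 0 N].

(* Entries and frequencies are 1-based (MATLAB convention): the entry y_k of
   the informal formula is nth 0 y k.-1. *)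
Definition IFFT (T : realType) (y : seq T[i]) (u : nat) : T[i] :=
  (size y)%:R^-1 *
  \sum_(1 <= k < (size y).+1)
     nth 0 y k.-1 *
     fourier_exp T (size y) ((k%:Z - 1) * (u%:Z - 1)).

(* On a sequence of even length N listed by the indices -N/2, ..., N/2 - 1,
   this puts the entry of index 0 first. *)
Definition fftshift (V : Type) (y : seq V) : seq V := rot (size y)./2 y.

(* Main.v *)
Require Import Defs.
From mathcomp Require Import all_boot all_order all_algebra.
From mathcomp Require Import complex.
From mathcomp Require Import reals sequences exp trigo.
From mathcomp Require Import ring lra zify.

Import Order.TTheory GRing.Theory Num.Theory.
Local Open Scope ring_scope.
Local Open Scope complex_scope.

(** Write [e x] for [fourier_exp T N x].  Since the phase factors have modulus
    one, each term of the recorded intensity expands as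
    [|A u|^2 + R^2 + R * (A u * e (- tau u) + (A u)^* * e (tau u))]
    ([normD_fourier_exp]).  Multiplying by [e (tau v)] and summing over [tau]
    leaves sums of characters [e (tau x)], where [x] is [v], [v - u] or [v + u].
    Such a sum is [N] when [N] divides [x] and [0] otherwise
    ([sum_centered_fourier_exp]).

    The decisive point is that [A] occupies only the first half of the
    frequencies: for [u, v < N/2] each of these three values of [x] has absolute
    value below [N], so it is divisible by [N] only if it vanishes.  The
    autocorrelation term therefore lives at [v = 0], the object term at
    [u = v], and its conjugate twin at [u = v = 0]; they do not overlap for
    [v > 0].  This is [hologram_dft].  At [v > 0] it reads [N * R * A v], which
    gives the reconstruction; at [v = 0] the terms of index [0] regroup into
    [|A 0 + R|^2], which gives the energy identity.

    The inverse FFT indexes samples from [0] rather than from [- N/2].  This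
    multiplies coefficient [u] by [e (N/2 * u) = (-1)^u], and the modulation by
    [exp (- j pi u)] cancels it ([IFFT_centered]); alternatively, [fftshift]
    reorders the samples so that positions and indices agree modulo [N], which
    is all that [e] sees ([IFFT_fftshift_centered]). *)

(** * Characters of the integers modulo N *)

Lemma cexpD (T : realType) (z w : T[i]) : cexp (z + w) = cexp z * cexp w.
Proof.
case: z w => [a b] [c d]; rewrite /cexp /= expRD cosD sinD.
by apply/eqP; rewrite eq_complex /=; apply/andP; split; apply/eqP; ring.
Qed.

Lemma cexp0 (T : realType) : cexp (0 : T[i]) = 1.
Proof. by rewrite /cexp /= expR0 cos0 sin0 mul1r. Qed.

Lemma fourier_expE (T : realType) (N : nat) (x : int) :
  fourier_exp T N x =
  cos (2 * pi / N%:R * x%:~R) +i* sin (2 * pi / N%:R * x%:~R).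
Proof.
rewrite /fourier_exp.
have -> : 'i%C * (2 * pi / N%:R)%:C * x%:~R
    = (0 +i* (2 * pi / N%:R * x%:~R)) :> T[i].
  rewrite -(rmorph_int (real_complex T)) -mulrA -rmorphM /=.
  by apply/eqP; rewrite eq_complex /=; apply/andP; split; apply/eqP; ring.
by rewrite /cexp /= expR0 mul1r.
Qed.

Lemma fourier_expD (T : realType) (N : nat) (x y : int) :
  fourier_exp T N (x + y) = fourier_exp T N x * fourier_exp T N y.
Proof. by rewrite /fourier_exp intrD mulrDr cexpD. Qed.

Lemma fourier_exp0 (T : realType) (N : nat) : fourier_exp T N 0 = 1.
Proof. by rewrite /fourier_exp mulr0 cexp0. Qed.

Lemma fourier_expN (T : realType) (N : nat) (x : int) :
  fourier_exp T N (- x) = (fourier_exp T N x)^*%R.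
Proof. by rewrite !fourier_expE intrN mulrN cosN sinN. Qed.

Lemma fourier_expMn (T : realType) (N n : nat) (x : int) :
  fourier_exp T N (x * n%:Z) = fourier_exp T N x ^+ n.
Proof.
elim: n => [|n IHn]; first by rewrite mulr0 fourier_exp0 expr0.
by rewrite exprS -IHn -fourier_expD intS mulrDr mulr1.
Qed.

Lemma fourier_exp_period (T : realType) (N : nat) (m : int) :
  (0 < N)%N -> fourier_exp T N (N%:Z * m) = 1.
Proof.
move=> N0.
have eN : fourier_exp T N N%:Z = 1.
  have -> : fourier_exp T N N%:Z = (cos (pi *+ 2) +i* sin (pi *+ 2)).
    by rewrite fourier_expE mulfVK ?pnatr_eq0 ?lt0n_neq0 // mulr_natl.
  by rewrite cos2pi sin2pi.
case: (intP m) => [|n|n]; first by rewrite mulr0 fourier_exp0.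
  by rewrite fourier_expMn eN expr1n.
by rewrite mulrN fourier_expN fourier_expMn eN expr1n rmorph1.
Qed.

(** By periodicity [x] may be replaced by its remainder [r].  For [0 < r < N] the
    half-angle [pi r / N] lies strictly between [0] and [pi], so its sine is
    positive, and the real part [1 - 2 sin^2] of [e r] is less than [1]. *)
Lemma fourier_exp_eq1 (T : realType) (N : nat) (x : int) :
  (0 < N)%N -> (fourier_exp T N x == 1) = (N%:Z %| x)%Z.
Proof.
move=> N0; have NR : N%:R != 0 :> T by rewrite pnatr_eq0 lt0n_neq0.
have NZ : N%:Z != 0 by rewrite eqz_nat lt0n_neq0.
rewrite {1}(divz_eq x N%:Z) fourier_expD mulrC [(_ * N%:Z)]mulrC.
rewrite fourier_exp_period // mulr1 (sameP dvdz_mod0P eqP).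
have := modz_ge0 x NZ; have := ltz_pmod x (N0 : 0 < N%:Z).
move: (x %% N)%Z => [] // r rN _.
case: (posnP r) => [->|r0]; first by rewrite fourier_exp0 !eqxx.
rewrite eqz_nat (gtn_eqF r0); apply/negbTE/eqP.
rewrite fourier_expE => /eqP; rewrite eq_complex /= => /andP[/eqP + _].
set t := pi / N%:R * r%:R : T.
have -> : 2 * pi / N%:R * r%:~R = t *+ 2 by rewrite /t -mulr_natl; field.
have t0 : 0 < sin t.
  apply: sin_gt0_pi; rewrite /t mulr_gt0 ?divr_gt0 ?pi_gt0 ?ltr0n //=.
  by rewrite mulrAC ltr_pdivrMr ?ltr0n // ltr_pM2l ?pi_gt0 // ltr_nat.
rewrite cos_mulr2n cos2sin2 => h.
have := exprn_gt0 2 t0; move: h; rewrite -mulr_natl; lra.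
Qed.

Lemma sum_centered (V : nmodType) (N : nat) (F : int -> V) :
  \sum_(tau <- centered N) F tau = \sum_(0 <= k < N) F (k%:Z - (N./2)%:Z).
Proof. by rewrite big_map /index_iota subn0. Qed.

(** Orthogonality of characters.  When [e x] is not [1], the sum is a multiple of
    a geometric sum of ratio [e x], which vanishes because [(e x)^N = 1]. *)
Lemma sum_centered_fourier_exp (T : realType) (N : nat) (x : int) :
  (0 < N)%N ->
  \sum_(tau <- centered N) fourier_exp T N (tau * x)
  = N%:R *+ (N%:Z %| x)%Z.
Proof.
move=> N0; rewrite sum_centered; case: (boolP (N%:Z %| x)%Z) => [|Nx].
  case/dvdzP=> m ->.
  under eq_bigr => k _ do rewrite mulrA mulrC fourier_exp_period //.
  by rewrite sumr_const_nat subn0.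
have e1 : fourier_exp T N x - 1 != 0 by rewrite subr_eq0 fourier_exp_eq1.
under eq_bigr => k _ do rewrite mulrBl fourier_expD [k%:Z * x]mulrC fourier_expMn.
rewrite -mulr_suml big_mkord; apply/eqP; rewrite mulf_eq0; apply/orP; left.
apply/eqP/(mulfI e1); rewrite -subrX1 -fourier_expMn mulrC.
by rewrite fourier_exp_period // subrr mulr0.
Qed.

(** * Intensity and its discrete Fourier transform *)

Lemma normD_fourier_exp (T : realType) (N : nat) (a : T[i]) (r : T) (x : int) :
  `|a + r%:C * fourier_exp T N x| ^+ 2 =
  `|a| ^+ 2 + r%:C ^+ 2
  + r%:C * (a * fourier_exp T N (- x) + a^*%R * fourier_exp T N x).
Proof.
have ee : fourier_exp T N x * fourier_exp T N (- x) = 1.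
  by rewrite -fourier_expD subrr fourier_exp0.
have rr : (r%:C)^*%R = r%:C by exact: conjc_real.
rewrite !normCK rmorphD rmorphM /= rr -fourier_expN.
rewrite -[r%:C ^+ 2]mulr1 -ee; ring.
Qed.

Lemma dvdz_small (d : nat) (x : int) :
  (`|x| < d)%N -> (d%:Z %| x)%Z = (x == 0).
Proof.
move=> xd; rewrite dvdzE /= -absz_eq0.
by case: posnP => [->//|x0]; rewrite ?dvdn0 // gtnNdvd.
Qed.

(** The discrete Fourier transform separates the three parts of the interference
    pattern: the object term [R * A v] is alone at every [v] in [1, N/2 - 1], and
    the autocorrelation and the conjugate twin image contribute at [v = 0]
    only. *)
Lemma hologram_dft (T : realType) (N : nat) (R : T) (A : nat -> T[i]) (v : nat) :
  (v < N./2)%N ->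
  \sum_(tau <- centered N)
     (\sum_(0 <= u < N./2) `|A u + R%:C * fourier_exp T N (tau * u%:Z)| ^+ 2)
     * fourier_exp T N (tau * v%:Z)
  = N%:R * (R%:C * A v
      + (\sum_(0 <= u < N./2) (`|A u| ^+ 2 + R%:C ^+ 2) + R%:C * (A 0%N)^*%R)
        *+ (v == 0%N)).
Proof.
move=> vN; have N0 : (0 < N)%N by lia.
under eq_bigr => tau _ do rewrite mulr_suml.
rewrite exchange_big /=.
have term (u : nat) : (u < N./2)%N ->
    \sum_(tau <- centered N)
       `|A u + R%:C * fourier_exp T N (tau * u%:Z)| ^+ 2
       * fourier_exp T N (tau * v%:Z)
    = N%:R * ((`|A u| ^+ 2 + R%:C ^+ 2) *+ (v == 0%N)
        + (if u == v then R%:C * A u else 0)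
        + (if u == 0%N then R%:C * (A u)^*%R *+ (v == 0%N) else 0)).
  move=> uN.
  have dv : (N%:Z %| v%:Z)%Z = (v == 0%N) by rewrite dvdz_small //; lia.
  have dB : (N%:Z %| v%:Z - u%:Z)%Z = (u == v) by rewrite dvdz_small; lia.
  have dD : (N%:Z %| v%:Z + u%:Z)%Z = (u == 0%N) && (v == 0%N).
    by rewrite dvdz_small; lia.
  have expand (tau : int) :
      `|A u + R%:C * fourier_exp T N (tau * u%:Z)| ^+ 2
        * fourier_exp T N (tau * v%:Z)
      = (`|A u| ^+ 2 + R%:C ^+ 2) * fourier_exp T N (tau * v%:Z)
        + R%:C * A u * fourier_exp T N (tau * (v%:Z - u%:Z))
        + R%:C * (A u)^*%R * fourier_exp T N (tau * (v%:Z + u%:Z)).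
    by rewrite normD_fourier_exp mulrBr (mulrDr tau) !fourier_expD; ring.
  rewrite (eq_bigr _ (fun tau _ => expand tau)) !big_split /= -!mulr_sumr.
  rewrite !sum_centered_fourier_exp // dv dB dD.
  by case: (u == v); case: (u == _); case: (v == _); rewrite /= ?mulr1n ?mulr0n; ring.
rewrite big_nat.
under eq_bigr => u /andP[_ uN] do rewrite term //.
rewrite -big_nat -mulr_sumr !big_split /= sumrMnl -!big_mkcond /= !big_nat1_eq /=.
rewrite vN (leq_ltn_trans _ vN) // big_split /= mulrnDl.
by congr (_ * _); ring.
Qed.

(** * The two inverse FFT conventions *)

Lemma IFFT_succ (T : realType) (y : seq T[i]) (u : nat) :
  IFFT y u.+1 = (size y)%:R^-1 *
    \sum_(0 <= k < size y) nth 0 y k * fourier_exp T (size y) (k%:Z * u%:Z).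
Proof.
rewrite /IFFT big_add1 /=; congr (_ * _); apply: eq_bigr => k _.
by congr (_ * fourier_exp _ _ _); rewrite !intS; ring.
Qed.

Lemma size_centered (N : nat) : size (centered N) = N.
Proof. by rewrite size_map size_iota. Qed.

Lemma nth_map_centered (V : nmodType) (N : nat) (J : int -> V) (k : nat) :
  (k < N)%N ->
  nth 0 [seq J tau | tau <- centered N] k = J (k%:Z - (N./2)%:Z).
Proof.
move=> kN; rewrite (nth_map 0) ?size_centered //.
by rewrite (nth_map 0%N) ?size_iota // nth_iota.
Qed.

(** The modulation [exp (- j pi u)] is the character value of the offset [- N/2]
    between 0-based positions and centered indices. *)
Lemma cexp_half_period (T : realType) (N u : nat) :
  (0 < N)%N -> ~~ odd N ->
  cexp (- 'i%C * pi%:C * (u.+1%:R - 1)) = fourier_exp T N (- (N./2)%:Z * u%:Z).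
Proof.
move=> N0 evN; rewrite /fourier_exp; congr cexp.
have NE : N%:R = 2 * (N./2)%:R :> T by rewrite -natrM; congr _%:R; lia.
have hC : (2 * pi / N%:R)%:C * (N./2)%:R = pi%:C :> T[i].
  rewrite -(rmorph_nat (real_complex T)) -rmorphM /=; congr _%:C.
  by rewrite NE; field; rewrite pnatr_eq0; lia.
by rewrite -hC intrM rmorphN /= -!pmulrn -addn1 natrD; ring.
Qed.

Lemma IFFT_centered (T : realType) (N u : nat) (J : int -> T[i]) :
  (0 < N)%N -> ~~ odd N ->
  IFFT [seq J tau | tau <- centered N] u.+1
    * cexp (- 'i%C * pi%:C * (u.+1%:R - 1))
  = N%:R^-1 * \sum_(tau <- centered N) J tau * fourier_exp T N (tau * u%:Z).
Proof.
move=> N0 evN; rewrite (cexp_half_period T N) // IFFT_succ size_map size_centered.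
rewrite -mulrA mulr_suml sum_centered; congr (_ * _).
apply: eq_big_nat => k /andP[_ kN]; rewrite nth_map_centered //.
by rewrite -mulrA -fourier_expD -mulrDl.
Qed.

(** Both sides split into halves of length [N/2], which correspond crosswise: in
    the second half of the shifted sequence, position and index differ by a full
    period [N]. *)
Lemma IFFT_fftshift_centered (T : realType) (N u : nat) (J : int -> T[i]) :
  (0 < N)%N -> ~~ odd N ->
  IFFT (fftshift [seq J tau | tau <- centered N]) u.+1
  = N%:R^-1 * \sum_(tau <- centered N) J tau * fourier_exp T N (tau * u%:Z).
Proof.
move=> N0 evN; rewrite IFFT_succ size_rot size_map size_centered sum_centered.
congr (_ * _).
have NE : N = (N./2 + N./2)%N by lia.
have sum_halves (V : nmodType) (F : nat -> V) :
    \sum_(0 <= k < N) F k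
    = \sum_(0 <= k < N./2) F k + \sum_(0 <= k < N./2) F (k + N./2)%N.
  rewrite (big_cat_nat (n := N./2)) //=; last by lia.
  by rewrite -{2}[N./2]add0n big_addn; congr (_ + \sum_(0 <= k < _) _); lia.
rewrite 2!sum_halves addrC /fftshift /rot size_map size_centered.
congr (_ + _); apply: eq_big_nat => k /andP[_ kN];
  rewrite nth_cat size_drop size_map size_centered.
- have -> : (k + N./2 < N - N./2)%N = false by lia.
  rewrite nth_take; last by lia.
  have -> : (k + N./2 - (N - N./2))%N = k by lia.
  rewrite nth_map_centered; last by lia.
  congr (_ * _).
  have -> : (k + N./2)%N%:Z * u%:Z = (k%:Z - (N./2)%:Z) * u%:Z + N%:Z * u%:Z.
    by rewrite -mulrDl; congr (_ * _); lia.
  by rewrite fourier_expD fourier_exp_period // mulr1.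
- have -> : (k < N - N./2)%N by lia.
  rewrite nth_drop nth_map_centered; last by lia.
  by congr (J _ * fourier_exp _ _ (_ * _)); lia.
Qed.

(** * Reconstruction of the object spectrum *)

Theorem proposition7 (T : realType) (N : nat) (R : T)
    (A : nat -> T[i]) (J : int -> T[i])
    (hN : (0 < N)%N) (N_even : ~~ odd N) (hR : 0 < R)
    (hJ : forall tau : int, - (N./2)%:Z <= tau <= (N./2)%:Z - 1 ->
       J tau = \sum_(0 <= u < N./2)
                 `|A u + R%:C * fourier_exp T N (tau * u%:Z)| ^+ 2) :
  [/\ forall u : nat, (1 <= u < N./2)%N ->
        A u = (R * N%:R)%:C^-1 *
              \sum_(tau <- centered N) J tau * fourier_exp T N (tau * u%:Z),
      `|A 0%N + R%:C| ^+ 2 =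
        N%:R^-1 * (\sum_(tau <- centered N) J tau)
        - (\sum_(1 <= u1 < N./2) `|A u1| ^+ 2
           + \sum_(1 <= u1 < N./2) R%:C ^+ 2)
    & forall a : nat -> T[i],
        (forall u : nat, (1 <= u <= N)%N ->
           a u = IFFT [seq J tau | tau <- centered N] u
                 * cexp (- 'i%C * pi%:C * (u%:R - 1)))
        \/
        (forall u : nat, (1 <= u <= N)%N ->
           a u = IFFT (fftshift [seq J tau | tau <- centered N]) u) ->
        (forall u : nat, (1 <= u < N./2)%N -> A u = R%:C^-1 * a u.+1)
        /\
        `|A 0%N + R%:C| ^+ 2 =
          N%:R^-1 * (\sum_(tau <- centered N) J tau)
          - (\sum_(1 <= u1 < N./2) `|A u1| ^+ 2
             + \sum_(1 <= u1 < N./2) R%:C ^+ 2)].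
Proof.
have h0 : (0 < N./2)%N by lia.
have NC : N%:R != 0 :> T[i] by rewrite pnatr_eq0 lt0n_neq0.
have RC : R%:C != 0 by rewrite fmorph_eq0 gt_eqF.
have dft (v : nat) : (v < N./2)%N ->
    \sum_(tau <- centered N) J tau * fourier_exp T N (tau * v%:Z)
    = N%:R * (R%:C * A v
      + (\sum_(0 <= u < N./2) (`|A u| ^+ 2 + R%:C ^+ 2) + R%:C * (A 0%N)^*%R)
        *+ (v == 0%N)).
  move=> vN; rewrite -hologram_dft // !sum_centered.
  by apply: eq_big_nat => k /andP[_ kN]; rewrite hJ //; lia.
have dft_pos (u : nat) : (1 <= u < N./2)%N ->
    \sum_(tau <- centered N) J tau * fourier_exp T N (tau * u%:Z)
    = N%:R * (R%:C * A u).
  by case/andP=> u0 uN; rewrite dft // gtn_eqF // mulr0n addr0.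
(* At frequency 0 both the object term and its twin survive; they complete
   [|A 0|^2 + R^2] to [|A 0 + R|^2]. *)
have energy : `|A 0%N + R%:C| ^+ 2 =
    N%:R^-1 * (\sum_(tau <- centered N) J tau)
    - (\sum_(1 <= u1 < N./2) `|A u1| ^+ 2 + \sum_(1 <= u1 < N./2) R%:C ^+ 2).
  have := dft 0%N h0; under eq_bigr => tau _ do rewrite mulr0 fourier_exp0 mulr1.
  move=> ->; rewrite mulKf // mulr1n big_ltn // big_split /=.
  have := @normD_fourier_exp T N (A 0%N) R 0.
  by rewrite oppr0 fourier_exp0 !mulr1 => ->; ring.
have recover (u : nat) : (1 <= u < N./2)%N -> A u = R%:C^-1 *
    (N%:R^-1 * \sum_(tau <- centered N) J tau * fourier_exp T N (tau * u%:Z)).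
  by move=> hu; rewrite dft_pos // !mulKf.
split=> // [u hu|a ha].
  by rewrite rmorphM rmorph_nat invfM /= -mulrA; exact: recover.
split=> // u hu; rewrite [LHS]recover //; congr (_ * _); symmetry.
have u1N : (1 <= u.+1 <= N)%N by lia.
case: ha => -> //; first exact: IFFT_centered.
exact: IFFT_fftshift_centered.
Qed.
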